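(* Let $\Delta$ be a Delzant polytope in $(\mathfrak{t}^{n})^{\ast}\cong\mathbb{R}^n$, let $V = \mathbb{R}p_{1} + \cdots + \mathbb{R}p_{n-1} + a$ be an $(n-1)$-dimensional affine subspace in $\mathfrak{t}^{n}\cong\mathbb{R}^n$ with rational slope, and let $X$ be the toric manifold associated with $\Delta$. If $V$ is admissible with respect to $\Delta$, then for every vertex $\lambda$ of $\Delta$ the rank of the Jacobian matrix $Df^{\lambda}$ is equal to one at every point of the zero locus of $f^{\lambda}$ in $\mathbb{C}^n$. In particular, $\overline{C(V)}$ is a smooth complex hypersurface in the toric manifold $X$.
   Context: Identify $\mathfrak{t}^n\cong\mathbb{R}^n$ and $(\mathfrak{t}^n)^*\cong\mathbb{R}^n$, with standard pairing $\langle\cdot,\cdot\rangle$. A convex polytope $\Delta\subset(\mathfrak{t}^n)^*$ is Delzant if each vertex $\lambda$ has exactly $n$ edges, whose direction vectors $v^\lambda_1,\dots,v^\lambda_n$ (pointing from $\lambda$ into the edges) can be chosen in $\mathbb{Z}^n$ and so that they form a $\mathbb{Z}$-basis of $\mathbb{Z}^n$; these are fixed for each vertex. Let $u^\lambda_1,\dots,u^\lambda_n\in\mathbb{Z}^n$ be the dual basis, $\langle u^\lambda_i,v^\lambda_j\rangle=\delta_{ij}$ (the inward normals to the $n$ facets through $\lambda$). The toric manifold $X$ associated with $\Delta$ has an open cover $\{U_\lambda\}$ indexed by the vertices $\lambda$ of $\Delta$, with charts $\varphi_\lambda:U_\lambda\to\mathbb{C}^n$, $\varphi_\lambda(U_\lambda)\cong\mathbb{C}^n$,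 with coordinates $z^\lambda=(z^\lambda_1,\dots,z^\lambda_n)$, and transition maps $\varphi_\sigma\circ\varphi_\lambda^{-1}(z^\lambda)=\left(\prod_{j}(z^\lambda_j)^{d^{\lambda\sigma}_{j1}},\dots,\prod_j(z^\lambda_j)^{d^{\lambda\sigma}_{jn}}\right)$, where $[d^{\lambda\sigma}_{ij}]=(Q^\lambda)^{-1}Q^\sigma$ and $Q^\lambda=[v^\lambda_1\,\cdots\,v^\lambda_n]$. An $(n-1)$-dimensional affine subspace $V\subset\mathfrak{t}^n$ with linear part $\vec V$ has rational slope if $\vec V\cap\mathbb{Z}^n\cong\mathbb{Z}^{n-1}$. Then $V=\mathbb{R}p_1+\cdots+\mathbb{R}p_{n-1}+a$ with $p_1,\dots,p_{n-1}\in\mathbb{Z}^n$ a $\mathbb{Z}$-basis of $\vec V\cap\mathbb{Z}^n$ and $a\in\mathbb{R}^n$. Let $q\in\mathbb{Z}^n$ be a primitive vector spanning the orthogonal complement of $\vec V$ in $\mathbb{R}^n$. The map $i_V:T^{n-1}\to T^n$, $i_V(t)=\left(\prod_l t_l^{\langle p_l,e_1\rangle},\dots,\prod_l t_l^{\langle p_l,e_n\rangle}\right)$, induces the pullback $i_V^*:(\mathfrak{t}^n)^*\to(\mathfrak{t}^{n-1})^*\cong\mathbb{R}^{n-1}$, $i_V^*(\xi)=(\langle p_1,\xi\rangle,\dots,\langle p_{n-1},\xi\rangle)$. For a vertex $\lambda$, put $\mathcal{I}^+_\lambda=\{i\mid\langle u^\lambda_i,q\rangle\ge0\}$, $\mathcal{I}^-_\lambda=\{i\mid\langle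 u^\lambda_i,q\rangle\le0\}$, $\mathcal{I}^0_\lambda=\{i\mid\langle u^\lambda_i,q\rangle=0\}$ (subsets of $\{1,\dots,n\}$), and $$f^\lambda(z^\lambda)=\prod_{j\in\mathcal{I}^+_\lambda\setminus\mathcal{I}^0_\lambda}(z^\lambda_j)^{\langle u^\lambda_j,q\rangle}-e^{\langle a,q\rangle}\prod_{j\in\mathcal{I}^-_\lambda\setminus\mathcal{I}^0_\lambda}(z^\lambda_j)^{-\langle u^\lambda_j,q\rangle},$$ with empty products equal to $1$. Let $\overline{C_\lambda(V)}\subset\mathbb{C}^n$ be the zero locus of $f^\lambda$, and $\overline{C(V)}=\bigcup_\lambda\varphi_\lambda^{-1}(\overline{C_\lambda(V)})\subset X$. A vertex $\lambda$ of $\Delta$ is good with respect to $i_V^*$ if (1) $i_V^*(\lambda)$ is a vertex of the convex polytope $i_V^*(\Delta)$, and (2) $i_V^*(v^\lambda_1),\dots,i_V^*(v^\lambda_n)$ are all nonzero. $V$ is admissible with respect to $\Delta$ if for every good vertex $\lambda$ there is $j\in\{1,\dots,n\}$ such that: the $n-1$ vectors $i_V^*(v^\lambda_i)$, $i\ne j$, are linearly independent and $i_V^*\left(\{\sum_{i=1}^n a_iv^\lambda_i\mid a_i\ge0\}\right)=\{\sum_{i\ne j}b_i\,i_V^*(v^\lambda_i)\mid b_i\ge0\}$; and these vectors $i_V^*(v^\lambda_i)$, $i\neq j$, form a $\mathbb{Z}$-basis of $\mathbb{Z}^{n-1}$. *)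

(* Defs.v *)
From HB Require Import structures.
From mathcomp Require Import all_boot all_order all_algebra.
From mathcomp Require Import complex.
From mathcomp Require Import all_classical all_reals all_analysis.
Set Implicit Arguments.
Unset Strict Implicit.
Unset Printing Implicit Defensive.
Import Order.TTheory GRing.Theory Num.Theory.
Import numFieldNormedType.Exports.
Local Open Scope classical_set_scope.
Local Open Scope ring_scope.
Local Open Scope complex_scope.

(* As a [numClosedFieldType], R[i] gets the topology of its norm, and the maps
   between the spaces 'rV[Cplx R]_n that are [differentiable] are those that are
   complex differentiable. *)
Definition Cplx (R : realType) : numClosedFieldType := R[i].

Definition pairing (K : nzRingType) n (x y : 'rV[K]_n) : K :=
  \sum_i x 0 i * y 0 i.

Definition realv (R : realType) n (x : 'rV[int]_n) : 'rV[R]_n := map_mx intr x.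
Arguments realv R {n} x.

Definition zbasis k n (b : 'I_k -> 'rV[int]_n) (L : set 'rV[int]_n) : Prop :=
  (forall c : 'I_k -> int, \sum_i c i *: b i = 0 -> forall i, c i = 0) /\
  L = range (fun c : 'I_k -> int => \sum_i c i *: b i).

Definition cone (R : realType) k n (b : 'I_k -> 'rV[R]_n) : set 'rV[R]_n :=
  [set \sum_i c i *: b i | c in [set c : 'I_k -> R | forall i, 0 <= c i]].

Definition convex_polytope (R : realType) n (P : set 'rV[R]_n) : Prop :=
  exists (k : nat) (b : 'I_k -> 'rV[R]_n),
    P = [set \sum_i c i *: b i |
         c in [set c : 'I_k -> R | (forall i, 0 <= c i) /\ \sum_i c i = 1]].

Definition face (R : realType) n (P F : set 'rV[R]_n) : Prop :=
  F !=set0 /\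
  exists c : 'rV[R]_n,
    F = [set x | P x /\ forall y, P y -> pairing c x <= pairing c y].

Definition segment (R : realType) n (x y : 'rV[R]_n) : set 'rV[R]_n :=
  [set (1 - t) *: x + t *: y | t in [set t : R | 0 <= t <= 1]].

Definition vertex (R : realType) n (P : set 'rV[R]_n) (x : 'rV[R]_n) : Prop :=
  face P [set x].

Definition edge (R : realType) n (P E : set 'rV[R]_n) : Prop :=
  face P E /\ exists x y, x <> y /\ E = segment x y.

Definition edge_directions (R : realType) n (P : set 'rV[R]_n) (l : 'rV[R]_n)
    (v : 'I_n -> 'rV[int]_n) : Prop :=
  zbasis v [set: 'rV[int]_n] /\
  exists E : 'I_n -> set 'rV[R]_n,
    [/\ injective E,
        forall F, edge P F /\ F l <-> exists i, F = E i
      & forall i, exists2 t : R, 0 < t & E i = segment l (l + t *: realv R (v i))].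

Definition delzant (R : realType) n (P : set 'rV[R]_n) : Prop :=
  convex_polytope P /\
  forall l, vertex P l -> exists v, edge_directions P l v.

Definition Qmx n (v : 'I_n -> 'rV[int]_n) : 'M[int]_n := \matrix_(i, j) v j 0 i.

(* The rows of Q^-1 are the basis dual to the columns of Q. *)
Definition dual_basis n (v : 'I_n -> 'rV[int]_n) (i : 'I_n) : 'rV[int]_n :=
  row i (invmx (Qmx v)).

Definition transition_exp n (v w : 'I_n -> 'rV[int]_n) : 'M[int]_n :=
  invmx (Qmx v) *m Qmx w.

Definition transition (R : realType) n (v w : 'I_n -> 'rV[int]_n)
    (z : 'rV[Cplx R]_n) : 'rV[Cplx R]_n :=
  \row_k \prod_j z 0 j ^ transition_exp v w j k.

(* The image of the overlap of two charts: the largest set on which the Laurent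
   monomials of the transition map are defined. *)
Definition transition_dom (R : realType) n (v w : 'I_n -> 'rV[int]_n) :
    set 'rV[Cplx R]_n :=
  [set z | forall j k, transition_exp v w j k < 0 -> z 0 j != 0].

(* The atlas, with its transition maps and their domains, determines the toric
   manifold up to biholomorphism.  [tcoord] is relevant only on [tdom], and all
   the data indexed by points only at the vertices of P. *)
Record toricManifold (R : realType) n (P : set 'rV[R]_n)
    (v : 'rV[R]_n -> 'I_n -> 'rV[int]_n) := ToricManifold {
  tcarrier :> topologicalType ;
  tdom : 'rV[R]_n -> set tcarrier ;
  tcoord : 'rV[R]_n -> tcarrier -> 'rV[Cplx R]_n ;
  tpoint : 'rV[R]_n -> 'rV[Cplx R]_n -> tcarrier ;
  thausdorff : hausdorff_space tcarrier ;
  tdom_open : forall l, vertex P l -> open (tdom l) ;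
  tdom_cover : \bigcup_(l in vertex P) tdom l = setT ;
  tpoint_dom : forall l, vertex P l -> forall z, tdom l (tpoint l z) ;
  tpointK : forall l, vertex P l -> cancel (tpoint l) (tcoord l) ;
  tcoordK : forall l, vertex P l -> {in tdom l, cancel (tcoord l) (tpoint l)} ;
  tcoord_continuous :
    forall l, vertex P l -> {within tdom l, continuous (tcoord l)} ;
  tpoint_continuous : forall l, vertex P l -> continuous (tpoint l) ;
  toverlap : forall l s, vertex P l -> vertex P s -> forall z,
    tdom s (tpoint l z) <-> transition_dom (v l) (v s) z ;
  ttransition : forall l s, vertex P l -> vertex P s -> forall z,
    tdom s (tpoint l z) ->
    tcoord s (tpoint l z) = transition (v l) (v s) z
}.

(* [jacobian] acts on row vectors, so this n x 1 matrix is the transpose of the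
   usual 1 x n Jacobian matrix. *)
Definition jac (R : realType) n (f : 'rV[Cplx R]_n -> Cplx R) (z : 'rV[Cplx R]_n) :
    'M[Cplx R]_(n, 1) :=
  jacobian (fun w => (f w)%:M : 'rV[Cplx R]_1) z.

Definition holomorphic_on (R : realType) n (P : set 'rV[R]_n) v
    (X : toricManifold P v) (W : set X) (g : X -> Cplx R) : Prop :=
  forall l, vertex P l -> forall z, W (tpoint X l z) ->
    differentiable (g \o tpoint X l) z.

(* Closed and locally the zero set of one holomorphic function whose Jacobian
   has rank one along that zero set. *)
Definition smooth_hypersurface (R : realType) n (P : set 'rV[R]_n) v
    (X : toricManifold P v) (S : set X) : Prop :=
  closed S /\
  forall x, S x -> exists (W : set X) (g : X -> Cplx R),
    [/\ open W, W x, holomorphic_on W g,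
        forall y, W y -> (S y <-> g y = 0)
      & forall l, vertex P l -> forall z, W (tpoint X l z) ->
          g (tpoint X l z) = 0 -> \rank (jac (g \o tpoint X l) z) = 1%N].

Definition affine_subspace (R : realType) n (k : nat) (V : set 'rV[R]_n) : Prop :=
  exists (B : 'M[R]_(k, n)) (a : 'rV[R]_n),
    row_free B /\ V = range (fun t : 'rV[R]_k => t *m B + a).

Definition direction (R : realType) n (V : set 'rV[R]_n) : set 'rV[R]_n :=
  [set x - y | x in V & y in V].

Definition lattice_points (R : realType) n (W : set 'rV[R]_n) : set 'rV[int]_n :=
  [set x | W (realv R x)].

Definition rational_slope (R : realType) m (V : set 'rV[R]_m.+1) : Prop :=
  exists f : {additive 'rV[int]_m -> 'rV[int]_m.+1},
    injective f /\ range f = lattice_points (direction V).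

Definition presentation (R : realType) m (V : set 'rV[R]_m.+1)
    (p : 'I_m -> 'rV[int]_m.+1) (a : 'rV[R]_m.+1) : Prop :=
  zbasis p (lattice_points (direction V)) /\
  V = range (fun t : 'I_m -> R => \sum_l t l *: realv R (p l) + a).

Definition primitive n (q : 'rV[int]_n) : Prop :=
  forall d : int, (forall i, (d %| q 0%R i)%Z) -> `|d|%N = 1%N.

Definition primitive_normal (R : realType) n (V : set 'rV[R]_n)
    (q : 'rV[int]_n) : Prop :=
  primitive q /\
  [set x | forall w, direction V w -> pairing w x = 0] =
    range (fun t : R => t *: realv R q).

(* The map i_V^*. *)
Definition pullback (K : nzRingType) k n (p : 'I_k -> 'rV[K]_n)
    (xi : 'rV[K]_n) : 'rV[K]_k :=
  \row_l pairing (p l) xi.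

Definition pullbackR (R : realType) k n (p : 'I_k -> 'rV[int]_n)
    (xi : 'rV[R]_n) : 'rV[R]_k :=
  pullback (fun l => realv R (p l)) xi.

Definition good (R : realType) k n (P : set 'rV[R]_n)
    (v : 'rV[R]_n -> 'I_n -> 'rV[int]_n) (p : 'I_k -> 'rV[int]_n)
    (l : 'rV[R]_n) : Prop :=
  [/\ vertex P l,
      vertex (pullbackR p @` P) (pullbackR p l)
    & forall i, pullbackR p (realv R (v l i)) <> 0].

(* [lift j] enumerates the indices different from j. *)
Definition admissible (R : realType) m (P : set 'rV[R]_m.+1)
    (v : 'rV[R]_m.+1 -> 'I_m.+1 -> 'rV[int]_m.+1)
    (p : 'I_m -> 'rV[int]_m.+1) : Prop :=
  forall l, good P v p l -> exists j : 'I_m.+1,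
    let w (i : 'I_m) := pullbackR p (realv R (v l (lift j i))) in
    [/\ row_free (\matrix_i w i),
        pullbackR p @` cone (fun i => realv R (v l i)) = cone w
      & zbasis (fun i : 'I_m => pullback p (v l (lift j i))) [set: 'rV[int]_m]].

Definition Iplus n (v : 'I_n -> 'rV[int]_n) (q : 'rV[int]_n) : {set 'I_n} :=
  [set i | 0 <= pairing (dual_basis v i) q]%SET.
Definition Iminus n (v : 'I_n -> 'rV[int]_n) (q : 'rV[int]_n) : {set 'I_n} :=
  [set i | pairing (dual_basis v i) q <= 0]%SET.
Definition Izero n (v : 'I_n -> 'rV[int]_n) (q : 'rV[int]_n) : {set 'I_n} :=
  [set i | pairing (dual_basis v i) q == 0]%SET.

Definition hyp_eq (R : realType) n (v : 'I_n -> 'rV[int]_n) (q : 'rV[int]_n)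
    (a : 'rV[R]_n) (z : 'rV[Cplx R]_n) : Cplx R :=
  \prod_(j in Iplus v q :\: Izero v q) z 0 j ^ pairing (dual_basis v j) q
  - (expR (pairing a (realv R q)))%:C *
    \prod_(j in Iminus v q :\: Izero v q) z 0 j ^ (- pairing (dual_basis v j) q).

Definition zero_locus (R : realType) n (f : 'rV[Cplx R]_n -> Cplx R) :
    set 'rV[Cplx R]_n := [set z | f z = 0].

(* [tpoint X l] is the inverse of the chart at l, so its direct image is the
   preimage under the chart. *)
Definition hypersurface (R : realType) n (P : set 'rV[R]_n) v
    (X : toricManifold P v) (q : 'rV[int]_n) (a : 'rV[R]_n) : set X :=
  \bigcup_(l in vertex P) (tpoint X l @` zero_locus (hyp_eq (v l) q a)).
Arguments hypersurface {R n P v} X q a _.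

(* Main.v *)
(* Write q = sum_i c_i v_i with c_i = <u_i, q>, so that f is
   z^(c^+) - e^<a,q> z^(c^-).  If all c_i have weakly the same sign, no z_i with
   c_i <> 0 vanishes on the zero locus and a logarithmic derivative of f is
   nonzero.  If both signs occur, no edge at the vertex is parallel to q, and there
   are x_i > 0 with sum_i x_i c_i = 0.  Then xi = sum_i x_i u_i is orthogonal to q,
   hence a functional on the image of i_V^*; as the polytope lies in the cone
   spanned by the edges at the vertex, xi exposes the image of the vertex, which is
   therefore good.  Admissibility then gives j with |c_j| = 1 and all other c_i of
   the opposite sign or zero, so f is affine in z_j with constant nonzero slope.
   In overlaps of charts the equations differ by a Laurent monomial, hence each of
   them cuts out the hypersurface on the whole domain of its chart. *)
Require Import Defs.
From mathcomp Require Import all_boot all_order all_algebra.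
From mathcomp Require Import complex.
From mathcomp Require Import all_classical all_reals all_analysis.
From mathcomp Require Import ring.
Import numFieldNormedType.Exports.
Import Order.TTheory GRing.Theory Num.Theory.
Local Open Scope classical_set_scope.
Local Open Scope ring_scope.

(** * The pairing, convex cones and Farkas' lemma *)

Lemma pairingE {K : nzRingType} {n} (x y : 'rV[K]_n) :
  pairing x y = (x *m y^T) 0 0.
Proof. by rewrite mxE; apply: eq_bigr => i _; rewrite mxE. Qed.

Lemma pairingDr {K : nzRingType} {n} (h x y : 'rV[K]_n) :
  pairing h (x + y) = pairing h x + pairing h y.
Proof. by rewrite !pairingE linearD mulmxDr mxE. Qed.

Lemma pairingC {K : comNzRingType} {n} (x y : 'rV[K]_n) :
  pairing x y = pairing y x.
Proof. by apply: eq_bigr => i _; rewrite mulrC. Qed.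

Lemma pairingBr {K : nzRingType} {n} (h x y : 'rV[K]_n) :
  pairing h (x - y) = pairing h x - pairing h y.
Proof. by rewrite !pairingE linearB mulmxBr !mxE. Qed.

Lemma pairingZr {K : comNzRingType} {n} (h x : 'rV[K]_n) t :
  pairing h (t *: x) = t * pairing h x.
Proof. by rewrite !pairingE linearZ -scalemxAr mxE. Qed.

Lemma pairing0r {K : nzRingType} {n} (h : 'rV[K]_n) : pairing h 0 = 0.
Proof. by rewrite pairingE trmx0 mulmx0 mxE. Qed.

Lemma pairing_sumr {K : nzRingType} {n k} (h : 'rV[K]_n)
    (x : 'I_k -> 'rV[K]_n) :
  pairing h (\sum_i x i) = \sum_i pairing h (x i).
Proof.
rewrite pairingE linear_sum mulmx_sumr summxE.
by apply: eq_bigr => i _; rewrite pairingE.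
Qed.

Lemma pairing_map {K L : nzRingType} (f : {rmorphism K -> L}) {n}
    (x y : 'rV[K]_n) : pairing (map_mx f x) (map_mx f y) = f (pairing x y).
Proof. by rewrite rmorph_sum; apply: eq_bigr => i _; rewrite rmorphM !mxE. Qed.

(** Kept abstract: any property stable under nonnegative combinations can serve as the cone in which
    [farkas] concludes. *)
Definition conic {K : realFieldType} {n} (C : set 'rV[K]_n) :=
  [/\ C 0, forall x y, C x -> C y -> C (x + y)
    & forall t x, 0 <= t -> C x -> C (t *: x)].

Lemma conic_sum {K : realFieldType} {n k} {C : set 'rV[K]_n}
    (t : 'I_k -> K) (x : 'I_k -> 'rV[K]_n) :
  conic C -> (forall i, 0 <= t i) -> (forall i, C (x i)) ->
  C (\sum_i t i *: x i).
Proof.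
by move=> [C0 CD CZ] t0 Cx; apply: big_ind => // i _; apply: CZ.
Qed.

(* Bartl's induction: if dropping [a] breaks the implication at a vector [x0],
   projecting along [x0] onto the orthogonal of [a] removes [a] from the list. *)
Lemma farkas {K : realFieldType} {n} (C : set 'rV[K]_n) (s : seq 'rV[K]_n) g :
  conic C -> {in s, forall a, C a} ->
  (forall h, {in s, forall a, 0 <= pairing h a} -> 0 <= pairing h g) -> C g.
Proof.
move=> cC; have [C0 CD CZ] := cC.
move: {2}(size s) (erefl (size s)) => k; elim: k s g => [|k IH] [|a s] // g.
  move=> _ _ gP; suff -> : g = 0 by [].
  apply/rowP => i; rewrite mxE.
  have gi h : 0 <= pairing h g by apply: gP.
  have pd : pairing (delta_mx 0 i) g = g 0 i.
    by rewrite pairingE -rowE !mxE.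
  apply/eqP; rewrite eq_le -{2}pd gi andbT -oppr_ge0 -pd.
  have := gi (- delta_mx 0 i).
  by rewrite pairingC -scaleN1r pairingZr mulN1r pairingC.
move=> [sk] sC gP.
have [/asboolP sP|/asboolPn] := boolP
    `[< forall h, {in s, forall b, 0 <= pairing h b} -> 0 <= pairing h g >].
  by apply: (IH s) => // b bs; apply: sC; rewrite inE bs orbT.
move=> /existsNP[x1 /not_implyP[x1s /negP]]; rewrite -ltNge => x1g.
have x1a : pairing x1 a < 0.
  rewrite ltNge; apply/negP => x1a; move: x1g; rewrite ltNge gP// => b.
  by rewrite inE => /orP[/eqP->//|/x1s].
pose x0 := (- (pairing x1 a)^-1) *: x1.
have x0E y : pairing x0 y = - (pairing x1 a)^-1 * pairing x1 y.
  by rewrite pairingC pairingZr pairingC.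
have lam0 : 0 < - (pairing x1 a)^-1 by rewrite oppr_gt0 invr_lt0.
have x0a : pairing x0 a = -1 by rewrite x0E mulNr mulVf// lt_eqF.
have x0g : pairing x0 g < 0 by rewrite x0E pmulr_rlt0.
have x0s b : b \in s -> 0 <= pairing x0 b.
  by move=> /x1s bs; rewrite x0E mulr_ge0// ltW.
pose pr y := y + pairing x0 y *: a.
have Ca : C a by apply: sC; rewrite inE eqxx.
(* The adjoint of [pr] sends [h] to [h + pairing h a *: x0], which vanishes at [a]; hence [gP]
   applies to it at the end. *)
have prE h y : pairing h (pr y) = pairing (h + pairing h a *: x0) y.
  rewrite /pr pairingDr pairingZr [RHS]pairingC pairingDr pairingZr.
  by rewrite (pairingC y h) (pairingC y x0) (mulrC (pairing x0 y)).
suff Cg : C (pr g).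
  have -> : g = pr g + (- pairing x0 g) *: a by rewrite /pr scaleNr addrK.
  by apply: CD => //; apply: CZ => //; rewrite oppr_ge0 ltW.
apply: (IH (map pr s)); rewrite ?size_map//.
  move=> _ /mapP[b bs ->]; apply: CD; first by apply: sC; rewrite inE bs orbT.
  by apply: CZ => //; apply: x0s.
move=> h hs; rewrite prE; apply: gP => b; rewrite inE => /orP[/eqP->|bs].
  by rewrite -prE /pr x0a scaleN1r subrr pairing0r.
by rewrite -prE; apply: hs; apply: map_f.
Qed.

(** Nonnegative values with sum zero are both zero, so the ray condition is stable under sums.
    Through [farkas] it passes from a list of generators to a redundant one. *)
Lemma conic_ray {K : realFieldType} {n} (h g : 'rV[K]_n) :
  conic [set x | 0 <= pairing h x /\
    (pairing h x = 0 -> exists2 t, 0 <= t & x = t *: g)].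
Proof.
split=> [|x y [hx xg] [hy yg]|t x t0 [hx xg]] /=.
- by rewrite pairing0r; split=> // _; exists 0; rewrite ?scale0r.
- rewrite pairingDr addr_ge0//; split=> // /eqP.
  rewrite paddr_eq0// => /andP[/eqP/xg[t t0 ->] /eqP/yg[u u0 ->]].
  by exists (t + u); rewrite ?addr_ge0// scalerDl.
- rewrite pairingZr mulr_ge0//; split=> // /eqP; rewrite mulf_eq0.
  move=> /orP[/eqP->|/eqP/xg[u u0 ->]].
    by exists 0; rewrite ?scale0r.
  by exists (t * u); rewrite ?mulr_ge0// scalerA.
Qed.

(* A pointed cone is generated by its exposed rays: among irredundant generators
   Farkas gives [h] negative at one generator [g] only, and adding a multiple of
   [c] makes it vanish there and positive at the others. *)
Lemma exposed_rays_generate {K : realFieldType} {n} (C : set 'rV[K]_n)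
    (c : 'rV[K]_n) (s : seq 'rV[K]_n) :
  conic C -> {in s, forall a, 0 < pairing c a} ->
  (forall g h, g \in s -> pairing h g = 0 ->
    {in s, forall a, 0 <= pairing h a} ->
    {in s, forall a, pairing h a = 0 -> exists2 t, 0 <= t & a = t *: g} ->
    C g) ->
  {in s, forall a, C a}.
Proof.
move=> cC; move: {2}(size s) (leqnn (size s)) => k.
elim: k s => [|k IH] s sk cs exC; first by move: sk; rewrite leqn0 => /nilP->.
have [[g [gs gP]]|/forallNP irr] := pselect (exists g, g \in s /\
    forall h, {in rem g (undup s), forall b, 0 <= pairing h b} ->
    0 <= pairing h g).
  pose s' := rem g (undup s).
  have s'E b : b \in s' = (b != g) && (b \in s).
    by rewrite mem_rem_uniq ?undup_uniq// inE/= mem_undup.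
  have s'C : {in s', forall a, C a}.
    apply: IH => [|a|g' h].
    - rewrite size_rem ?mem_undup// -subn1 leq_subLR add1n.
      by rewrite (leq_trans (size_undup s)).
    - by rewrite s'E => /andP[_ /cs].
    - rewrite s'E => /andP[g'g g's] hg' hs' hray.
      (* A functional exposing a ray among [s'] exposes it among [s] too, since [g] lies in the cone
         of [s']. *)
      have := farkas _ s' g (conic_ray h g') _ gP => /=.
      case=> [b bs'|hg hg0]; first by split; [exact: hs'|exact: hray].
      apply: (exC g' h) => // b bs; have [->//|bg] := eqVneq b g.
        by apply: hs'; rewrite s'E bg.
      by apply: hray; rewrite s'E bg.
  move=> a as_; have [->|ag] := eqVneq a g; first exact: farkas gP.
  by apply: s'C; rewrite s'E ag.
move=> g gs; have /not_andP[//|/existsNP[h /not_implyP[hs /negP]]] := irr g.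
rewrite -ltNge => hg; have cg := cs g gs.
pose r := - pairing h g / pairing c g.
have r0 : 0 < r by rewrite divr_gt0// oppr_gt0.
have hE x : pairing (h + r *: c) x = pairing h x + r * pairing c x.
  by rewrite pairingC pairingDr pairingZr pairingC (pairingC x).
have hg0 : pairing (h + r *: c) g = 0.
  by rewrite hE /r divfK ?gt_eqF// subrr.
have hpos a : a \in s -> a != g -> 0 < pairing (h + r *: c) a.
  move=> as_ ag; rewrite hE; apply: ltr_wpDl; last by rewrite mulr_gt0// cs.
  by apply: hs; rewrite mem_rem_uniq ?undup_uniq// inE/= ag mem_undup.
apply: (exC g (h + r *: c)) => // a as_.
  by have [->|/(hpos _ as_)/ltW//] := eqVneq a g; rewrite hg0.
have [-> _|/(hpos _ as_)/gt_eqF/eqP//] := eqVneq a g.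
by exists 1; rewrite ?scale1r.
Qed.

(** * Vertices, edges and strict minimisers on a polytope *)

Lemma convex_polytope_convex {R : realType} {n} (P : set 'rV[R]_n) x y t :
  convex_polytope P -> P x -> P y -> 0 <= t <= 1 -> P ((1 - t) *: x + t *: y).
Proof.
move=> [k [b ->]] [c [c0 c1] <-] [d [d0 d1] <-] /andP[t0 t1].
exists (fun i => (1 - t) * c i + t * d i).
  split=> [i|]; first by rewrite addr_ge0// mulr_ge0// subr_ge0.
  by rewrite big_split/= -!mulr_sumr c1 d1 !mulr1 subrK.
rewrite !scaler_sumr -big_split/=.
by apply: eq_bigr => i _; rewrite !scalerA -scalerDl.
Qed.

Lemma vertexP {R : realType} {n} (P : set 'rV[R]_n) l : vertex P l ->
  P l /\ exists c, forall y, P y ->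
    pairing c l <= pairing c y /\ (pairing c l = pairing c y -> y = l).
Proof.
move=> [_ [c lE]]; have Fl : [set l] l by [].
rewrite lE in Fl; have [Pl lmin] := Fl; split=> //; exists c => y Py.
split=> [|ly]; first exact: lmin.
suff : [set l] y by [].
by rewrite lE; split=> // z Pz; rewrite -ly; exact: lmin.
Qed.

(* Every exposed ray of the cone generated by [P - l] is spanned by an edge of
   [P] at [l], hence by one of the [v i]. *)
Lemma vertex_strict_min {R : realType} {n} (P : set 'rV[R]_n) l
    (v : 'I_n -> 'rV[int]_n) xi :
  convex_polytope P -> vertex P l -> edge_directions P l v ->
  (forall i, 0 < pairing xi (realv R (v i))) ->
  forall y, P y -> y <> l -> pairing xi l < pairing xi y.
Proof.
move=> cP vl [_ [E [_ EP Eseg]]] xi0 y Py yl.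
have [Pl [c cmin]] := vertexP _ _ vl.
pose C := [set x : 'rV[R]_n | x = 0 \/ 0 < pairing xi x].
have cC : conic C.
  split=> [|x z [->|x0] [->|z0]|t x]; rewrite /C /=; try by left.
  - by left; rewrite addr0.
  - by right; rewrite add0r.
  - by right; rewrite addr0.
  - by right; rewrite pairingDr addr_gt0.
  - rewrite le_eqVlt => /orP[/eqP<- _|t0 [->|x0]].
    + by left; rewrite scale0r.
    + by left; rewrite scaler0.
    + by right; rewrite pairingZr mulr_gt0.
have [k [b PE]] := cP.
have Pb i : P (b i).
  rewrite PE; exists (fun j => (i == j)%:R).
    split=> [j|]; first exact: ler0n.
    rewrite (bigD1 i)//= eqxx big1 ?addr0// => j /negPf.
    by rewrite eq_sym => ->.
  rewrite (bigD1 i)//= eqxx scale1r big1 ?addr0// => j /negPf.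
  by rewrite eq_sym => ->; rewrite scale0r.
(* Generators of the cone spanned by [P - l]; zero is left out because [c] has to be positive on
   each. *)
pose s : seq 'rV[R]_n := [seq x <- codom (fun i => b i - l) | x != 0].
have sP g : g \in s -> exists2 i, b i != l & g = b i - l.
  rewrite mem_filter => /andP[g0 /codomP[i gE]]; exists i => //.
  by rewrite -subr_eq0 -gE.
have sb i : b i != l -> b i - l \in s.
  by move=> bi; rewrite mem_filter subr_eq0 bi codom_f.
have cs : {in s, forall g, 0 < pairing c g}.
  move=> _ /sP[i bi ->]; have [le_l eq_l] := cmin _ (Pb i).
  rewrite pairingBr subr_gt0 lt_neqAle le_l andbT.
  by apply: contraNneq bi => /eq_l ->.
have sC : {in s, forall g, C g}.
  apply: (exposed_rays_generate _ c _ cC cs) => _ h /sP[i0 bi0 ->].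
  set g := b i0 - l => hg hs ray.
  have cg : 0 < pairing c g by apply: cs; exact: sb.
  have hb i : pairing h l <= pairing h (b i).
    have [->//|bi] := eqVneq (b i) l.
    by rewrite -subr_ge0 -pairingBr hs// sb.
  pose t i := pairing c (b i - l) / pairing c g.
  have t_ge0 i : 0 <= t i.
    rewrite divr_ge0 ?(ltW cg)// pairingBr subr_ge0.
    by have [] := cmin _ (Pb i).
  have tE i : pairing h (b i) = pairing h l -> b i - l = t i *: g.
    move=> hbi; have [bil|bi] := eqVneq (b i) l.
      by rewrite /t bil subrr pairing0r mul0r scale0r.
    have [|u u0 uE] := ray _ (sb _ bi); first by rewrite pairingBr hbi subrr.
    by rewrite /t uE pairingZr mulfK ?gt_eqF.
  have hl0 : pairing h (b i0) == pairing h l.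
    by rewrite -subr_eq0 -pairingBr hg.
  (* With [t] measuring position along the ray of [g], the farthest generator is the other endpoint
     of the edge exposed by [h]. *)
  have [im /eqP him tmax] :=
    @arg_maxP _ R _ i0 (fun i => pairing h (b i) == pairing h l) t hl0.
  have T1 : 1 <= t im.
    by have := tmax _ hl0; rewrite /t -/g divff ?gt_eqF.
  have T0 : 0 < t im by rewrite (lt_le_trans ltr01).
  pose F := [set x | P x /\ forall z, P z -> pairing h x <= pairing h z].
  have hP z : P z -> pairing h l <= pairing h z.
    rewrite PE => -[d [d0 d1] <-]; rewrite pairing_sumr.
    rewrite -[leLHS]mul1r -d1 mulr_suml; apply: ler_sum => i _.
    by rewrite pairingZr ler_wpM2l.
  have Fl : F l by [].
  have FE : F = segment l (l + t im *: g).
    apply/seteqP; split=> [x [Px xmin]|_ [u u01 <-]].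
    - have hx : pairing h x = pairing h l.
        by apply/eqP; rewrite eq_le xmin// hP.
      move: Px hx; rewrite PE => -[d [d0 d1] <-] hx.
      (* A convex combination minimises [h] only if its weight sits on generators that minimise
         [h]. *)
      have d0' i : d i * (pairing h (b i) - pairing h l) = 0.
        move: i (erefl true); apply/psumr_eq0P => [i _|].
          by rewrite mulr_ge0// subr_ge0.
        apply/eqP; under eq_bigr do rewrite mulrBr.
        rewrite sumrB -mulr_suml d1 mul1r subr_eq0 -hx pairing_sumr.
        by apply/eqP; apply: eq_bigr => i _; rewrite pairingZr.
      have dE i : d i *: (b i - l) = (d i * t i) *: g.
        have /eqP := d0' i; rewrite mulf_eq0 subr_eq0 => /orP[/eqP->|/eqP hbi].
          by rewrite mul0r !scale0r.
        by rewrite tE// scalerA.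
      exists ((\sum_i d i * t i) / t im).
        rewrite /= divr_ge0 ?(ltW T0)//=; last first.
          by apply: sumr_ge0 => i _; rewrite mulr_ge0.
        rewrite ler_pdivrMr// mul1r -[leRHS]mul1r -d1 mulr_suml.
        apply: ler_sum => i _.
        have /eqP := d0' i; rewrite mulf_eq0 subr_eq0 => /orP[/eqP->|hbi].
          by rewrite !mul0r.
        by apply: ler_wpM2l => //; exact: tmax.
      rewrite scalerDr addrA -scalerDl subrK scale1r scalerA divfK ?gt_eqF//.
      rewrite scaler_suml; under eq_bigr do rewrite -dE scalerBr.
      by rewrite sumrB -scaler_suml d1 scale1r addrC subrK.
    - have lb : l + t im *: g = b im by rewrite -tE// addrC subrK.
      rewrite lb; split; first exact: convex_polytope_convex.
      move=> z Pz; rewrite pairingDr !pairingZr him -mulrDl subrK mul1r.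
      exact: hP.
  have [|i Fi] := (EP F).1.
    split=> //; split; first by split; [exists l|exists h].
    exists l, (l + t im *: g); split=> // /eqP.
    rewrite -subr_eq0 opprD addrA subrr add0r oppr_eq0 scaler_eq0 gt_eqF//=.
    by move=> /eqP g0; rewrite g0 pairing0r ltxx in cg.
  (* The edge [F] is also a segment from [l] along [v i], so [g] is a positive multiple of [v i]. *)
  have [w w0 Ei] := Eseg i.
  have : F (l + t im *: g).
    rewrite FE; exists 1; first by rewrite /= ler01 lexx.
    by rewrite subrr scale0r add0r scale1r.
  rewrite Fi Ei => -[u /andP[u0 u1]] /eqP.
  rewrite scalerDr addrA -scalerDl subrK scale1r => /eqP /addrI ug.
  right; suff: 0 < pairing xi (t im *: g) by rewrite pairingZr pmulr_rgt0.
  rewrite -ug !pairingZr mulr_gt0 ?mulr_gt0//.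
  rewrite lt_neqAle u0 andbT; apply/eqP => u00.
  move: ug; rewrite -u00 scale0r => /esym/eqP; rewrite scaler_eq0 gt_eqF//=.
  by move=> /eqP g0; rewrite g0 pairing0r ltxx in cg.
have : C (y - l).
  move: Py; rewrite PE => -[d [d0 d1] <-].
  rewrite -[l]scale1r -d1 scaler_suml -sumrB.
  under eq_bigr do rewrite -scalerBr.
  apply: conic_sum => // i; have [->|bi] := eqVneq (b i) l.
    by rewrite subrr; left.
  by apply: sC; exact: sb.
by move=> [/eqP|]; rewrite ?subr_eq0 ?pairingBr ?subr_gt0// => /eqP.
Qed.

(** * Lattice bases and the coordinates of [q] *)

Lemma zbasis_unitmx {n} (v : 'I_n -> 'rV[int]_n) :
  zbasis v [set: 'rV[int]_n] -> Qmx v \in unitmx.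
Proof.
move=> [_ vT]; rewrite -unitmx_tr.
(* The coordinates of the standard basis vectors form a left inverse of the transposed matrix. *)
have /choice[C CE] (j : 'I_n) :
    exists c : 'I_n -> int, \sum_i c i *: v i = delta_mx 0 j.
  have : [set: 'rV[int]_n] (delta_mx 0 j) by [].
  by rewrite vT => -[c _ <-]; exists c.
suff /mulmx1_unit[] : (\matrix_(j, i) C j i) *m (Qmx v)^T = 1%:M by [].
apply/matrixP => j k; rewrite mxE.
have /rowP/(_ k) := CE j; rewrite summxE !mxE /= eq_sym => <-.
by apply: eq_bigr => i _; rewrite !mxE.
Qed.

(** This is [Q (Q^-1 q) = q], read entrywise. *)
Lemma dual_basis_sum {n} (v : 'I_n -> 'rV[int]_n) q : Qmx v \in unitmx ->
  \sum_i pairing (dual_basis v i) q *: v i = q.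
Proof.
move=> Qu; apply/rowP => k; rewrite summxE.
have /colP/(_ k) := mulKVmx Qu q^T; rewrite [in RHS]mxE => <-.
rewrite mxE; apply: eq_bigr => i _; rewrite !mxE mulrC; congr (_ * _).
by apply: eq_bigr => j _; rewrite !mxE.
Qed.

Lemma pairing_dual_basis {n} (v : 'I_n -> 'rV[int]_n) i j : Qmx v \in unitmx ->
  pairing (dual_basis v i) (v j) = (i == j)%:R.
Proof.
move=> Qu; have /matrixP/(_ i j) := mulVmx Qu; rewrite [RHS]mxE => <-.
by rewrite mxE; apply: eq_bigr => k _; rewrite !mxE.
Qed.

(** A common divisor of the coordinates of [q] in the basis [v] divides each entry of [q]. *)
Lemma primitive_dual {n} (v : 'I_n -> 'rV[int]_n) q d :
  Qmx v \in unitmx -> primitive q ->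
  (forall i, (d %| pairing (dual_basis v i) q)%Z) -> `|d|%N = 1%N.
Proof.
move=> Qu qP dc; apply: qP => k; rewrite -[q](dual_basis_sum v)// summxE.
by apply: rpred_sum => i _; rewrite mxE dvdz_mulr.
Qed.

(** * The map i_V^* and its kernel *)

Lemma pairing_realv {R : realType} {n} (x y : 'rV[int]_n) :
  pairing (realv R x) (realv R y) = (pairing x y)%:~R.
Proof. exact: pairing_map. Qed.

Lemma realv_sum {R : realType} {n k} (c : 'I_k -> int)
    (x : 'I_k -> 'rV[int]_n) :
  realv R (\sum_i c i *: x i) = \sum_i (c i)%:~R *: realv R (x i).
Proof.
rewrite /realv raddf_sum /=.
by apply: eq_bigr => i _; rewrite map_mxZ.
Qed.

Lemma pullback_sum {n k j} (p : 'I_k -> 'rV[int]_n)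
    (c : 'I_j -> int) (x : 'I_j -> 'rV[int]_n) :
  pullback p (\sum_i c i *: x i) = \sum_i c i *: pullback p (x i).
Proof.
apply/rowP => l; rewrite mxE summxE pairing_sumr.
by apply: eq_bigr => i _; rewrite pairingZr !mxE.
Qed.

Lemma pullbackR_realv {R : realType} {n k} (p : 'I_k -> 'rV[int]_n) x :
  pullbackR p (realv R x) = realv R (pullback p x).
Proof. by apply/rowP => l; rewrite !mxE pairing_realv. Qed.

Section Slope.
Context {R : realType} {m : nat} {V : set 'rV[R]_m.+1}.
Context {p : 'I_m -> 'rV[int]_m.+1} {a : 'rV[R]_m.+1} {q : 'rV[int]_m.+1}.
Hypotheses (Vpa : presentation V p a) (Vq : primitive_normal V q).

Lemma direction_span w : direction V w ->
  exists t : 'I_m -> R, w = \sum_l t l *: realv R (p l).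
Proof.
move=> [x]; rewrite Vpa.2 => -[t _ <-] [_ [u _ <-] <-].
exists (fun l => t l - u l); rewrite opprD addrACA subrr addr0 -sumrB.
by apply: eq_bigr => l _; rewrite scalerBl.
Qed.

Lemma pairing_slope_normal l : pairing (p l) q = 0.
Proof.
apply/eqP; rewrite -(intr_eq0 R) -pairing_realv; apply/eqP.
have : range (fun t : R => t *: realv R q) (realv R q).
  by exists 1 => //; rewrite scale1r.
rewrite -Vq.2; apply; have : lattice_points (direction V) (p l); last by [].
rewrite Vpa.1.2; exists (fun i => (i == l)%:R) => //.
rewrite (bigD1 l)//= eqxx scale1r big1 ?addr0// => i /negPf->.
by rewrite scale0r.
Qed.

Lemma pullback_normal : pullback p q = 0.
Proof. by apply/rowP => l; rewrite !mxE pairing_slope_normal. Qed.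

(** The kernel of i_V^* is orthogonal to the [p l], hence to the direction of [V], whose orthogonal
    complement is the line of [q]. *)
Lemma pullbackR_eq0 x : pullbackR p x = 0 -> exists t, x = t *: realv R q.
Proof.
move=> /rowP px; suff : range (fun t : R => t *: realv R q) x.
  by move=> [t _ <-]; exists t.
rewrite -Vq.2 => w /direction_span[t ->]; rewrite pairingC pairing_sumr.
apply: big1 => l _; rewrite pairingZr pairingC.
by have := px l; rewrite !mxE => ->; rewrite mulr0.
Qed.

(** The columns of [cokermx M] lie in the kernel of i_V^*, so they are multiples of [q] and [xi]
    annihilates them; thus [xi] is in the row space of [M], and its coefficients there give
    [eta]. *)
Lemma pullback_functional xi : pairing xi (realv R q) = 0 ->
  exists eta : 'rV[R]_m, forall y, pairing eta (pullbackR p y) = pairing xi y.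
Proof.
move=> xiq; pose M := \matrix_l realv R (p l).
have pM y : pullbackR p y = (M *m y^T)^T.
  apply/rowP => l; rewrite !mxE.
  by apply: eq_bigr => i _; rewrite !mxE.
have /submxP[D ->] : (xi <= M)%MS.
  rewrite submxE; apply/eqP/rowP => k; rewrite [RHS]mxE.
  have [|t tE] := pullbackR_eq0 (col k (cokermx M))^T.
    rewrite pM trmxK colE mulmxA mulmx_coker mul0mx.
    by apply/rowP => l; rewrite !mxE.
  have := pairingZr xi (realv R q) t; rewrite -tE xiq mulr0 => <-.
  by rewrite mxE; apply: eq_bigr => i _; rewrite !mxE.
by exists D => y; rewrite pM !pairingE trmxK mulmxA.
Qed.

End Slope.

(** * Signs and divisibility of the coordinates of [q] at a vertex *)

Lemma positive_relation {K : realFieldType} {n} (c : 'I_n -> K) i k :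
  0 < c i -> c k < 0 ->
  exists x : 'I_n -> K, (forall j, 0 < x j) /\ \sum_j x j * c j = 0.
Proof.
move=> ci ck; pose S := \sum_j c j.
(* All weights start at 1; raising the one at [r] by [- S / c r] brings the sum to zero, so [c r]
   must not have the sign of [S]. *)
have [r [cr Sr]] : exists r, c r != 0 /\ 0 <= - S / c r.
  have [S0|S0] := leP 0 S; [exists k|exists i].
    split; first by rewrite lt_eqF.
    by apply: mulr_le0; rewrite ?oppr_le0 ?invr_le0// (ltW ck).
  by split; [rewrite gt_eqF|apply: mulr_ge0; rewrite ?oppr_ge0 ?invr_ge0 ltW].
exists (fun j => 1 + (j == r)%:R * (- S / c r)); split=> [j|].
  by rewrite ltr_pwDl// mulr_ge0.
under eq_bigr do rewrite mulrDl mul1r.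
rewrite big_split/= -/S (bigD1 r)//= eqxx mul1r divfK// big1 ?addr0 ?subrr//.
by move=> j /negPf->; rewrite !mul0r.
Qed.

(** In the mixed case the images [y i] of the edges satisfy [\sum_i c i *: y i = 0]. Admissibility
    makes [y j] a combination of the others with coefficients [e i] that are nonnegative integers,
    so [c (lift j i) = - c j * e i]: signs oppose, and [c j] divides every coordinate of the
    primitive vector [q]. *)
Lemma admissible_coef {R : realType} {m} {Delta : set 'rV[R]_m.+1}
    {v : 'rV[R]_m.+1 -> 'I_m.+1 -> 'rV[int]_m.+1} {V : set 'rV[R]_m.+1}
    {p : 'I_m -> 'rV[int]_m.+1} {a : 'rV[R]_m.+1} {q : 'rV[int]_m.+1} {l} :
  convex_polytope Delta -> edge_directions Delta l (v l) ->
  presentation V p a -> primitive_normal V q -> admissible Delta v p ->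
  vertex Delta l ->
  let c i := pairing (dual_basis (v l) i) q in
  [\/ forall i, 0 <= c i, forall i, c i <= 0 |
      exists j, `|c j| = 1 /\ forall i, i != j -> c i * c j <= 0].
Proof.
move=> cP ve Vpa Vq adm vl c.
have Qu := zbasis_unitmx _ ve.1.
have cq : \sum_i c i *: v l i = q by exact: dual_basis_sum.
have [/asboolP c_ge0|/asboolPn/existsNP[k /negP]] :=
  boolP `[< forall i, 0 <= c i >]; first exact: Or31.
have [/asboolP c_le0|/asboolPn/existsNP[i /negP]] :=
  boolP `[< forall i, c i <= 0 >]; first by move=> _; exact: Or32.
rewrite -!ltNge => ci ck; apply: Or33.
have gl : good Delta v p l.
  split=> //; last first.
    (* If the edge [r] were mapped to zero, [v l r] would be a multiple of [q], and [q] would have a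
       single nonzero coordinate, against the two signs at [i] and [k]. *)
    move=> r /(pullbackR_eq0 Vpa Vq)[t tq].
    have tc j : t * (c j)%:~R = (j == r)%:R.
      have := pairingZr (realv R (dual_basis (v l) j)) (realv R q) t.
      by rewrite -tq !pairing_realv pairing_dual_basis// => <-; case: (j == r).
    have t0 : t != 0.
      apply/eqP => t0; have := tc r; rewrite t0 mul0r eqxx => /eqP.
      by rewrite eq_sym oner_eq0.
    have cr j : c j != 0 -> j = r.
      move=> cj; apply/eqP; have := tc j; case: eqP => // _ /eqP.
      by rewrite mulf_eq0 intr_eq0 (negPf t0) (negPf cj).
    have ir : i = r by apply: cr; rewrite gt_eqF.
    have kr : k = r by apply: cr; rewrite lt_eqF.
    by move: ck; rewrite kr -ir ltNge ltW.
  (* These weights make [xi] vanish on [q] and be positive on every edge direction. *)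
  have [x [x0 xc]] := positive_relation (fun j => (c j)%:~R : R) i k
    ltac:(by rewrite ltr0z) ltac:(by rewrite ltrz0).
  pose xi := \sum_j x j *: realv R (dual_basis (v l) j).
  have xiE y : pairing xi y =
      \sum_j x j * pairing (realv R (dual_basis (v l) j)) y.
    rewrite pairingC pairing_sumr.
    by apply: eq_bigr => j _; rewrite pairingZr pairingC.
  have xiv j : 0 < pairing xi (realv R (v l j)).
    rewrite xiE (bigD1 j)//= big1 ?addr0.
      by rewrite pairing_realv pairing_dual_basis// eqxx mulr1.
    move=> i' /negPf ji.
    by rewrite pairing_realv pairing_dual_basis// ji mulr0.
  have [|eta etaE] := pullback_functional Vpa Vq xi.
    by rewrite xiE -[RHS]xc; apply: eq_bigr => j _; rewrite pairing_realv.
  have [Dl _] := vertexP _ _ vl.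
  have xi_min y : Delta y -> pairing xi l <= pairing xi y /\
      (pairing xi y <= pairing xi l -> y = l).
    move=> Dy; have [->//|/eqP yl] := eqVneq y l.
    have := vertex_strict_min _ _ _ _ cP vl ve xiv _ Dy yl.
    by move=> ly; split; [exact: ltW|rewrite leNgt ly].
  split; first by exists (pullbackR p l).
  exists eta; apply/seteqP; split=> [_ ->|_ [[y Dy <-] ymin]] /=.
    split; first by exists l.
    by move=> _ [y Dy <-]; rewrite !etaE; have [] := xi_min y Dy.
  have := ymin (pullbackR p l); rewrite !etaE => yl.
  by have [_ ->//] := xi_min y Dy; apply: yl; exists l.
have [j [free coneE [indep spanE]]] := adm _ gl.
pose y i := pullback p (v l i).
have [e eE] : exists e : 'I_m -> int, \sum_i e i *: y (lift j i) = y j.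
  have : [set: 'rV[int]_m] (y j) by [].
  by rewrite spanE => -[e _ <-]; exists e.
have yc : \sum_i c i *: y i = 0.
  by rewrite -pullback_sum cq (pullback_normal Vpa Vq).
have ce i' : c (lift j i') = - c j * e i'.
  apply/eqP; rewrite -subr_eq0 mulNr opprK; apply/eqP; move: i'; apply: indep.
  rewrite -[RHS]yc (bigD1_ord j)//= -eE scaler_sumr -big_split/=.
  by apply: eq_bigr => i' _; rewrite scalerDl scalerA addrC.
(* The cone condition gives nonnegative real coefficients; linear independence over the reals
   identifies them with [e]. *)
have e_ge0 i' : 0 <= e i'.
  have : cone (fun i => pullbackR p (realv R (v l (lift j i))))
      (pullbackR p (realv R (v l j))).
    rewrite -coneE; exists (realv R (v l j)) => //.
    exists (fun i => (i == j)%:R) => [i''|]; first exact: ler0n.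
    rewrite (bigD1 j)//= eqxx scale1r big1 ?addr0// => i'' /negPf->.
    by rewrite scale0r.
  move=> [b b0]; rewrite pullbackR_realv -/(y j) -eE realv_sum => be.
  have : \row_i (b i - (e i)%:~R) = 0 :> 'rV[R]_m.
    apply: (row_free_inj free); rewrite mul0mx mulmx_sum_row.
    under eq_bigr do rewrite rowK mxE scalerBl.
    rewrite sumrB be; apply/eqP; rewrite subr_eq0; apply/eqP/eq_bigr => i'' _.
    by rewrite pullbackR_realv.
  move=> /rowP/(_ i'); rewrite !mxE => /eqP; rewrite subr_eq0 => /eqP bi.
  by rewrite -(ler0z R) -bi; exact: b0.
exists j; split.
  suff : `|c j|%N = 1%N by rewrite -abszE => ->.
  apply: (primitive_dual _ _ _ Qu Vq.1) => i'.
  case: (unliftP j i') => [i'' ->|->//].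
  by rewrite -/(c _) ce mulNr rpredN dvdz_mulr.
move=> i'; case: (unliftP j i') => [i'' ->|->]; last by rewrite eqxx.
by rewrite ce mulrAC mulNr -expr2 mulNr oppr_le0 mulr_ge0// sqr_ge0.
Qed.

(** * Differentiation of Laurent monomials *)

Lemma near_eq_differentiable {K : numFieldType} {U W : normedModType K}
    (f g : U -> W) x : (\near x, f x = g x) ->
  differentiable f x -> differentiable g x.
Proof.
move=> fg df; have [dfc /eqaddoP dfE] := (diff_locallyP _ _).1 df.
(* The first-order expansion depends only on the germ, so ['d f x] is also a differential for
   [g]. *)
have gE : g \o shift x = cst (g x) + 'd f x +o_ 0 id.
  apply/eqaddoP => e e0; have := dfE e e0.
  move=> h.
  have h' : \forall y \near (0 : U), f (y + x) = g (y + x).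
    by move: fg; rewrite (near_shift 0)/= subr0.
  near=> y.
  have -> : (g \o shift x - (cst (g x) + 'd f x)) y =
     (f \o shift x - (cst (f x) + 'd f x)) y.
    by rewrite /= !fctE /= (nbhs_singleton fg) (near h' y).
  by near: y.
have dgE := diff_unique dfc gE.
by apply/diff_locallyP; rewrite dgE.
Unshelve. all: by end_near. Qed.

Lemma differentiable_prod {K : numFieldType} {U : normedModType K} {I : Type}
    (s : seq I) (f : I -> U -> K) x :
  (forall i, differentiable (f i) x) ->
  differentiable (fun y => \prod_(i <- s) f i y) x.
Proof.
move=> df; elim: s => [|i s IH].
  under eq_fun do rewrite big_nil; exact: differentiable_cst.
under eq_fun do rewrite big_cons; exact: differentiableM.
Qed.

Lemma differentiable_exprz {K : numFieldType} {U : normedModType K}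
    (f : U -> K) (k : int) x : differentiable f x ->
  (k < 0 -> f x != 0) -> differentiable (fun y => f y ^ k) x.
Proof.
have dX d : differentiable f x -> differentiable (fun y => f y ^+ d) x.
  case: d => [_|d df]; last by rewrite -exprfctE; exact: differentiableX.
  by under eq_fun do rewrite expr0; exact: differentiable_cst.
move=> df; case: k => d fx; first exact: dX.
(* For [k = Negz d] the power is by definition the inverse of the power [d.+1]. *)
change (differentiable (fun y => (f y ^+ d.+1)^-1) x).
apply: differentiableV; first exact: dX.
by rewrite expf_neq0// fx.
Qed.

Lemma differentiable_row {K : numFieldType} {U : normedModType K} {n}
    (f : 'I_n -> U -> K) x :
  (forall i, differentiable (f i) x) ->
  differentiable (fun y => \row_i f i y) x.
Proof.
move=> df.
have -> : (fun y => \row_i f i y) =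
    \sum_(i < n) (fun y => f i y *: (delta_mx 0 i : 'rV[K]_n)).
  apply/funext => y; rewrite fct_sumE [LHS]row_sum_delta.
  by apply: eq_bigr => i _; rewrite mxE.
by apply: differentiable_sum => i; apply: differentiableZl.
Qed.

(** Integer exponents cover both the terms of the equations and the components of transition maps. A
    zero coordinate with negative exponent contributes the default value 0. *)
Definition monomial {K : fieldType} {n} (e : 'I_n -> int) (z : 'rV[K]_n) : K :=
  \prod_j z 0 j ^ e j.

Lemma differentiable_monomial {K : numFieldType} {n} (e : 'I_n -> int)
    (z : 'rV[K]_n) :
  (forall j, e j < 0 -> z 0 j != 0) -> differentiable (monomial e) z.
Proof.
move=> ez; apply: differentiable_prod => j.
apply: (differentiable_exprz (fun w : 'rV[K]_n => w 0 j)) => [|/ez//].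
exact: differentiable_coord.
Qed.

Lemma monomial_line {K : numFieldType} {n} (e : 'I_n -> int)
    (z : 'rV[K]_n) j h :
  monomial e (h *: delta_mx 0 j + z) =
  (h + z 0 j) ^ e j * \prod_(i | i != j) z 0 i ^ e i.
Proof.
rewrite /monomial (bigD1 j)//= !mxE !eqxx mulr1; congr (_ * _).
by apply: eq_bigr => i /negPf ij; rewrite !mxE eqxx ij mulr0 add0r.
Qed.

(** On the line in direction [j] the function is the one-variable polynomial [phi]. When [e j] is 0
    the truncated predecessor is harmless, as the factor [(e j)%:R] vanishes. *)
Lemma derive_binomial {K : numFieldType} {n} (e d : 'I_n -> nat) (E : K)
    (z : 'rV[K]_n) j :
  'D_(delta_mx 0 j) (fun w => monomial e w - E * monomial d w) z =
  (e j)%:R * z 0 j ^+ (e j).-1 * (\prod_(i | i != j) z 0 i ^+ e i) -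
  E * ((d j)%:R * z 0 j ^+ (d j).-1 * (\prod_(i | i != j) z 0 i ^+ d i)).
Proof.
set A := \prod_(i | i != j) z 0 i ^+ e i.
set B := \prod_(i | i != j) z 0 i ^+ d i.
pose phi (t : K) := A * t ^+ e j - E * (B * t ^+ d j).
have phiE h : monomial e (h *: delta_mx 0 j + z) -
    E * monomial d (h *: delta_mx 0 j + z) = phi (h + z 0 j).
  by rewrite !monomial_line /phi !(mulrC A) !(mulrC B).
transitivity ('D_1 phi (z 0 j)).
  rewrite /derive; congr (lim _); apply: (congr1 (fun g => g @ 0^')).
  apply/funext => h /=; rewrite phiE; have := phiE 0.
  by rewrite scale0r !add0r => ->; rewrite -[h *: 1]/(h * 1) mulr1.
have -> : phi = A \*: (fun t => t ^+ e j) - (E * B) \*: (fun t => t ^+ d j).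
  by apply/funext => t; rewrite /phi mulrA.
have dX k : derivable (fun t : K => t ^+ k) (z 0 j) 1 by exact: exprn_derivable.
rewrite deriveB; try exact: derivableZ.
rewrite !deriveZ ?exp_derive//.
rewrite /GRing.scale/= !mulr1; ring.
Qed.

(** * Rank of the Jacobian matrix *)

Lemma mul_jac {R : realType} {n} (f : 'rV[Cplx R]_n -> Cplx R) z u :
  differentiable f z -> u *m jac f z = ('d f z u)%:M.
Proof.
move=> df; rewrite /jac /jacobian mul_rV_lin1.
have -> : (fun w => (f w)%:M : 'rV[Cplx R]_1) = (fun w => f w *: 1%:M).
  by apply/funext => w; rewrite scalemx1.
by rewrite diffZl// scalemx1.
Qed.

(** A one-column matrix has rank one exactly when it is nonzero, and its rows are the values of
    ['d f z] on the standard basis. *)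
Lemma rank_jacP {R : realType} {n} (f : 'rV[Cplx R]_n -> Cplx R) z :
  differentiable f z ->
  \rank (jac f z) = 1%N <-> exists u, 'd f z u != 0.
Proof.
move=> df; split=> [rk|[u du]].
  apply/not_existsP => d0; suff J0 : jac f z = 0 by rewrite J0 mxrank0 in rk.
  apply/row_matrixP => i; rewrite rowE mul_jac// row0.
  by have /negP := d0 (delta_mx 0 i); rewrite negbK => /eqP ->; rewrite raddf0.
apply/eqP; rewrite eqn_leq rank_leq_col lt0n mxrank_eq0.
apply: contraNneq du => J0; have := mul_jac f z u df; rewrite J0 mulmx0.
by move=> /matrixP/(_ 0 0); rewrite !mxE eqxx mulr1n => /esym/eqP.
Qed.

(** * The equations as differences of monomials, and their change of charts *)

Definition pos_part (k : int) : nat := if k is Posz d then d else 0.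

Lemma pos_part_neg k : k <= 0 -> pos_part k = 0%N.
Proof. by case: k => // -[]. Qed.

Lemma pos_part_pos k : 0 < k -> k = pos_part k.
Proof. by case: k. Qed.

Lemma pos_partB k : (pos_part k)%:Z - (pos_part (- k))%:Z = k.
Proof.
have [k0|k0|->//] := ltrgt0P k.
  by rewrite (pos_part_neg (- k)) ?oppr_le0 ?ltW// subr0 -pos_part_pos.
by rewrite (pos_part_neg k) ?ltW// -pos_part_pos ?oppr_gt0// sub0r opprK.
Qed.

(** Indices outside the two sets get exponent 0 through [pos_part] and contribute a factor 1, so
    both products may run over all indices. *)
Lemma hyp_eqE {R : realType} {n} (v : 'I_n -> 'rV[int]_n) q (a : 'rV[R]_n) z :
  let c j := pairing (dual_basis v j) q in
  hyp_eq v q a z = monomial (fun j => pos_part (c j)) z -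
    (expR (pairing a (realv R q)))%:C%C *
    monomial (fun j => pos_part (- c j)) z.
Proof.
move=> c; rewrite /hyp_eq /monomial; congr (_ - _ * _).
  rewrite big_mkcond; apply: eq_bigr => j _ /=; rewrite !inE -/(c j).
  rewrite -lt0r; case: ltP => [c0|/pos_part_neg->].
    by rewrite -pos_part_pos.
  by rewrite expr0z.
rewrite big_mkcond; apply: eq_bigr => j _ /=; rewrite !inE -/(c j).
rewrite -lt_neqAle -oppr_gt0; case: ltP => [c0|/pos_part_neg->].
  by rewrite -pos_part_pos.
by rewrite expr0z.
Qed.

Lemma prod_exprz {K : fieldType} {n} (x : K) (e : 'I_n -> int) :
  (x = 0 -> forall k, 0 <= e k) -> \prod_k x ^ e k = x ^ (\sum_k e k).
Proof.
have [-> e0|x0 _] := eqVneq x 0; last first.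
  by rewrite (big_morph _ (fun i j => expfzDr i j x0) (expr0z x)).
have eE k : e k = `|e k|%N by rewrite gez0_abs ?e0.
under eq_bigr do rewrite eE; under [in RHS]eq_bigr do rewrite eE.
rewrite -(big_morph Posz PoszD (erefl (Posz 0))) -!exprnP prodrXr//.
Qed.

(** Where [z 0 j] vanishes, row [j] of the transition matrix is nonnegative on [transition_dom], so
    the powers still add up. *)
Lemma monomial_transition {R : realType} {n} (v w : 'I_n -> 'rV[int]_n)
    (e : 'I_n -> nat) z : transition_dom v w z ->
  monomial e (transition v w z : 'rV[Cplx R]_n) =
  monomial (fun j => \sum_k transition_exp v w j k * e k) z.
Proof.
move=> zdom; rewrite /monomial.
under eq_bigr do rewrite mxE.
transitivity (\prod_k \prod_j z 0 j ^ (transition_exp v w j k * (e k)%:Z)).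
  apply: eq_bigr => k _; rewrite -exprnP -prodrXl.
  by apply: eq_bigr => j _; rewrite exprnP exprz_exp.
rewrite exchange_big/=; apply: eq_bigr => j _; rewrite prod_exprz// => zj k.
rewrite mulr_ge0//; case: leP => // /(zdom j k); by rewrite zj eqxx.
Qed.

(** At a zero coordinate powers need not add when the exponents have opposite signs, hence the
    condition. *)
Lemma monomialD {K : fieldType} {n} (e d : 'I_n -> int) (z : 'rV[K]_n) :
  (forall j, z 0 j = 0 -> 0 <= e j /\ 0 <= d j) ->
  monomial (fun j => e j + d j) z = monomial e z * monomial d z.
Proof.
move=> ed; rewrite /monomial -big_split/=; apply: eq_bigr => j _.
have := ed j; have [-> /(_ erefl)[ej dj]|zj _] := eqVneq (z 0 j) 0.
  by rewrite -(gez0_abs ej) -(gez0_abs dj) -PoszD -!exprnP exprD.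
by rewrite expfzDr.
Qed.

(** From [Q_v^-1 Q_w Q_w^-1 = Q_v^-1]. *)
Lemma transition_dual {n} (v w : 'I_n -> 'rV[int]_n) q j : Qmx w \in unitmx ->
  \sum_k transition_exp v w j k * pairing (dual_basis w k) q =
  pairing (dual_basis v j) q.
Proof.
move=> Qw; rewrite !pairingE /dual_basis -!row_mul.
have -> : invmx (Qmx v) *m q^T =
    transition_exp v w *m (invmx (Qmx w) *m q^T).
  by rewrite /transition_exp -mulmxA mulKVmx.
rewrite [in RHS]mxE [in RHS]mxE; apply: eq_bigr => k _.
by congr (_ * _); rewrite pairingE -row_mul [LHS]mxE.
Qed.

(* With [D] the exponent matrix and [c], [c'] the coefficients of [q] in the two
   charts, [D c' = c], so both [D c'^+] and [D c'^-] exceed [c^+] and [c^-] by the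
   same integer vector [r]; the equation at [w] pulls back to [z^r] times that at
   [v]. *)
Lemma hyp_eq_transition {R : realType} {n} (v w : 'I_n -> 'rV[int]_n) q
    (a : 'rV[R]_n) z : Qmx w \in unitmx -> transition_dom v w z ->
  hyp_eq v q a z = 0 -> hyp_eq w q a (transition v w z) = 0.
Proof.
move=> Qw zdom; rewrite !hyp_eqE !monomial_transition//.
set E := (_%:C)%C; set D := transition_exp v w.
pose c j := pairing (dual_basis v j) q; pose c' j := pairing (dual_basis w j) q.
pose r j : int := \sum_k D j k * pos_part (c' k) - (pos_part (c j))%:Z.
have rE j : \sum_k D j k * pos_part (- c' k) - (pos_part (- c j))%:Z = r j.
  have DB : \sum_k D j k * pos_part (c' k) - \sum_k D j k * pos_part (- c' k) =
      (pos_part (c j))%:Z - (pos_part (- c j))%:Z.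
    rewrite pos_partB -[RHS](transition_dual v w q j Qw) -sumrB.
    by apply: eq_bigr => k _; rewrite -mulrBr pos_partB.
  rewrite /r -[X in _ = X - _](subrK (\sum_k D j k * pos_part (- c' k))) DB.
  ring.
have r_ge0 j : z 0 j = 0 -> 0 <= r j.
  move=> zj; have D0 k : 0 <= D j k.
    by case: leP => // /(zdom j k); rewrite zj eqxx.
  (* One of [c j] and [- c j] has positive part 0; the matching formula for [r j] is a sum of
     nonnegative terms. *)
  have [cj|cj] := leP (c j) 0.
    rewrite /r pos_part_neg// subr0.
    by apply: sumr_ge0 => k _; rewrite mulr_ge0.
  rewrite -rE (pos_part_neg (- c j)) ?oppr_le0 ?(ltW cj)// subr0.
  by apply: sumr_ge0 => k _; rewrite mulr_ge0.
have split_r (e e' : 'I_n -> nat) :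
    (forall j, \sum_k D j k * e' k - (e j)%:Z = r j) ->
    monomial (fun j => \sum_k D j k * e' k) z = monomial r z * monomial e z.
  move=> eE; rewrite -monomialD => [|j /r_ge0//].
  by apply: eq_bigr => j _; rewrite -eE subrK.
rewrite (split_r (fun j => pos_part (c j)) (fun k => pos_part (c' k)))//.
rewrite (split_r (fun j => pos_part (- c j)) (fun k => pos_part (- c' k)))//.
by rewrite mulrCA -mulrBr => ->; rewrite mulr0.
Qed.

(** * Rank one along the zero locus *)

Lemma partial_monomial_neq0 {K : numFieldType} {n} (e : 'I_n -> nat)
    (z : 'rV[K]_n) j : (0 < e j)%N ->
  monomial e z != 0 \/ e j = 1%N /\ (forall i, i != j -> e i = 0%N) ->
  (e j)%:R * z 0 j ^+ (e j).-1 * (\prod_(i | i != j) z 0 i ^+ e i) != 0.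
Proof.
(* In the second case the monomial is the coordinate itself, with derivative 1; in the first none of
   its factors vanishes, and [e j] is nonzero in characteristic 0. *)
move=> ej; case=> [|[-> e0]]; last first.
  rewrite mul1r mul1r big1 ?oner_eq0// => i /e0 ->.
  by rewrite expr0.
rewrite /monomial (bigD1 j)//= -exprnP mulf_eq0 negb_or expf_eq0 ej /=.
move=> /andP[zj A]; apply: mulf_neq0 => //; apply: mulf_neq0.
  by rewrite pnatr_eq0 -lt0n.
by rewrite expf_neq0.
Qed.

Lemma differentiable_hyp_eq {R : realType} {n} (v : 'I_n -> 'rV[int]_n) q
    (a : 'rV[R]_n) z : differentiable (hyp_eq v q a) z.
Proof.
rewrite (funext (hyp_eqE v q a)).
apply: differentiableB; first exact: differentiable_monomial.
apply: differentiableM; first exact: differentiable_cst.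
exact: differentiable_monomial.
Qed.

Lemma hyp_eq_rank {R : realType} {n} (v : 'I_n -> 'rV[int]_n) q
    (a : 'rV[R]_n) z :
  let c i := pairing (dual_basis v i) q in
  Qmx v \in unitmx -> primitive q ->
  [\/ forall i, 0 <= c i, forall i, c i <= 0 |
      exists j, `|c j| = 1 /\ forall i, i != j -> c i * c j <= 0] ->
  hyp_eq v q a z = 0 -> \rank (jac (hyp_eq v q a) z) = 1%N.
Proof.
move=> c Qv qP cP fz; apply/rank_jacP; first exact: differentiable_hyp_eq.
set E : Cplx R := (expR (pairing a (realv R q)))%:C%C.
have E0 : E != 0 by rewrite (inj_eq (@complexI _)) gt_eqF// expR_gt0.
have [i0 ci0] : exists i, c i != 0.
  apply/not_existsP => c0; suff : `|0%:Z|%N = 1%N by [].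
  apply: (primitive_dual v q) => // i; rewrite dvd0z.
  by have /negP := c0 i; rewrite negbK.
(* The coordinate to differentiate in: any with nonzero exponent if the signs agree, the
   distinguished one otherwise. *)
have [j [cj jP]] : exists j, c j != 0 /\ ((forall i, 0 <= c i * c j) \/
    `|c j| = 1 /\ forall i, i != j -> c i * c j <= 0).
  case: cP => [c0|c0|[j [cj1 cj]]].
  - by exists i0; split=> //; left=> i; rewrite mulr_ge0.
  - by exists i0; split=> //; left=> i; rewrite mulr_le0.
  - by exists j; split; [rewrite -normr_eq0 cj1|right].
exists (delta_mx 0 j); rewrite -deriveE; last exact: differentiable_hyp_eq.
have fE := funext (hyp_eqE v q a).
rewrite fE (derive_binomial (fun j => pos_part (c j))
  (fun j => pos_part (- c j))).
move: fz; rewrite fE => /eqP; rewrite subr_eq0 => /eqP fz.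
have mono0 (e : 'I_n -> nat) : (forall i, e i = 0%N) -> monomial e z = 1.
  by move=> e0; rewrite /monomial big1// => i _; rewrite e0 expr0z.
have [cj0|cj0|cj0] := ltrgt0P (c j); last by rewrite cj0 eqxx in cj.
- rewrite (pos_part_neg (- c j)) ?oppr_le0 ?(ltW cj0)// !mul0r mulr0 subr0.
  apply: partial_monomial_neq0; first by rewrite -ltz_nat -pos_part_pos.
  (* If the signs agree, the second monomial is 1, so the first equals [E] on the zero locus;
     otherwise the first is [z 0 j]. *)
  case: jP => [cpos|[cj1 cneg]]; [left|right].
    rewrite fz mulf_neq0// mono0 ?oner_eq0// => i; rewrite pos_part_neg//.
    by rewrite oppr_le0 -(pmulr_lge0 (c i) cj0); exact: cpos.
  split=> [|i /cneg]; last by rewrite pmulr_lle0// => /pos_part_neg.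
  by have -> : c j = 1 by rewrite -cj1 gtr0_norm.
- rewrite (pos_part_neg (c j)) ?(ltW cj0)// !mul0r sub0r oppr_eq0.
  have ncj0 : 0 < - c j by rewrite oppr_gt0.
  apply: mulf_neq0 => //.
  apply: partial_monomial_neq0; first by rewrite -ltz_nat -pos_part_pos.
  case: jP => [cpos|[cj1 cneg]]; [left|right].
    (* Here the first monomial is 1, so [E] times the second is 1 on the zero locus. *)
    apply: contraTneq E0 => m0; rewrite m0 mulr0 mono0 in fz.
      by have /eqP := fz; rewrite oner_eq0.
    by move=> i; rewrite pos_part_neg// -(nmulr_lge0 (c i) cj0); exact: cpos.
  split=> [|i /cneg].
    by have -> : - c j = 1 by rewrite -cj1 ltr0_norm.
  by rewrite nmulr_lle0// => ci; rewrite pos_part_neg// oppr_le0.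
Qed.

(** * The hypersurface in the charts of the toric manifold *)

Lemma differentiable_transition {R : realType} {n} (v w : 'I_n -> 'rV[int]_n)
    (z : 'rV[Cplx R]_n) :
  transition_dom v w z -> differentiable (transition v w) z.
Proof.
move=> zdom; apply: differentiable_row => k.
apply: (@differentiable_monomial (Cplx R) n (fun j => transition_exp v w j k)).
by move=> j; exact: zdom.
Qed.

Lemma diff_near_comp {K : numFieldType} {U V W : normedModType K} (f : U -> W)
    (g : V -> W) (T : U -> V) w u :
  differentiable f w -> differentiable T w -> differentiable g (T w) ->
  (\forall y \near w, g (T y) = f y) -> 'd f w u = 'd g (T w) ('d T w u).
Proof.
move=> df dT dg gT; have dgT : differentiable (g \o T) w.
  exact: differentiable_comp.
rewrite -(deriveE _ df) -(near_eq_derive u gT) -/(g \o T) (deriveE _ dgT).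
by rewrite (diff_comp dT dg).
Qed.

(** By the chain rule ['d T w] carries a direction where ['d f w] is nonzero to one where
    ['d g (T w)] is. *)
Lemma rank_jac_factor {R : realType} {n} (f g : 'rV[Cplx R]_n -> Cplx R)
    (T : 'rV[Cplx R]_n -> 'rV[Cplx R]_n) w :
  differentiable f w -> differentiable T w -> differentiable g (T w) ->
  (\forall y \near w, g (T y) = f y) ->
  \rank (jac f w) = 1%N -> \rank (jac g (T w)) = 1%N.
Proof.
move=> df dT dg gT /(rank_jacP _ _ df)[u du]; apply/rank_jacP => //.
by exists ('d T w u); rewrite -(diff_near_comp f).
Qed.

Section ToricHypersurface.
Context {R : realType} {n : nat} {P : set 'rV[R]_n}.
Context {v : 'rV[R]_n -> 'I_n -> 'rV[int]_n} (X : toricManifold P v).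
Context (q : 'rV[int]_n) (a : 'rV[R]_n).
Hypothesis Qv : forall l, vertex P l -> Qmx (v l) \in unitmx.

(** A point of the hypersurface satisfies the equation of some chart; [hyp_eq_transition] moves this
    to the chart at [l]. *)
Lemma hypersurface_chart l (x : X) : vertex P l -> tdom l x ->
  hypersurface X q a x <-> hyp_eq (v l) q a (tcoord l x) = 0.
Proof.
move=> vl lx; split=> [[s vs [z fz zx]]|fx].
  move: lx; rewrite -zx => lz; have -> := ttransition vs vl lz.
  apply: hyp_eq_transition => //; first exact: Qv.
  exact: (toverlap X vs vl z).1 lz.
by exists l => //; exists (tcoord l x) => //; rewrite tcoordK// inE.
Qed.

Lemma tcoord_continuous_at l (x : X) : vertex P l -> tdom l x ->
  {for x, continuous (tcoord (t := X) l)}.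
Proof.
move=> vl lx; have := @tcoord_continuous _ _ _ _ X l vl.
by rewrite (continuous_open_subspace _ (tdom_open X vl)); apply; rewrite inE.
Qed.

(** Off the hypersurface the equation of a chart is nonzero, and by continuity it stays nonzero
    nearby. *)
Lemma closed_hypersurface : closed (hypersurface X q a).
Proof.
rewrite -openC openE => x Sx.
have [l vl lx] : (\bigcup_(l in vertex P) tdom l) x by rewrite tdom_cover.
have fx : hyp_eq (v l) q a (tcoord l x) != 0.
  by apply/eqP => /hypersurface_chart; apply: contra_not Sx; exact.
have fc : {for x, continuous (hyp_eq (v l) q a \o tcoord l)}.
  apply: continuous_comp; first exact: tcoord_continuous_at.
  exact/differentiable_continuous/differentiable_hyp_eq.
have lxn : \forall y \near x, tdom l y.
  by apply: open_nbhs_nbhs; split=> //; exact: (tdom_open X vl).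
have fn : \forall y \near x, (hyp_eq (v l) q a \o tcoord l) y != 0.
  exact: (cvgr_neq0 _ fc).
rewrite /interior; near=> y => /hypersurface_chart Sy.
have /eqP : (hyp_eq (v l) q a \o tcoord l) y != 0 by near: y.
by apply; apply: Sy => //; near: y.
Unshelve. all: by end_near. Qed.

Lemma near_tdom l s z : vertex P l -> vertex P s -> tdom l (tpoint X s z) ->
  \forall w \near z, tdom l (tpoint X s w).
Proof.
move=> vl vs lz.
apply: (@tpoint_continuous _ _ _ _ X s vs z (tdom l)).
by apply: open_nbhs_nbhs; split=> //; exact: (tdom_open X vl).
Qed.

Lemma near_hyp_eq_transition l s z : vertex P l -> vertex P s ->
  tdom l (tpoint X s z) ->
  \forall w \near z, (hyp_eq (v l) q a \o transition (v s) (v l)) w =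
    (hyp_eq (v l) q a \o tcoord l \o tpoint X s) w.
Proof.
move=> vl vs lz; near=> w; rewrite /= (ttransition vs vl)//.
by near: w; exact: near_tdom.
Unshelve. all: by end_near. Qed.

(** Near [z] the function agrees with the equation composed with the explicit monomial transition,
    which is differentiable on its domain. *)
Lemma differentiable_chart l s z : vertex P l -> vertex P s ->
  tdom l (tpoint X s z) ->
  differentiable (hyp_eq (v l) q a \o tcoord l \o tpoint X s) z.
Proof.
move=> vl vs lz.
apply: (near_eq_differentiable _ _ _ (near_hyp_eq_transition _ _ _ vl vs lz)).
apply: differentiable_comp; last exact: differentiable_hyp_eq.
by apply: differentiable_transition; exact: (toverlap X vs vl z).1 lz.
Qed.

(* The equation in the chart at [l] is the one read in the chart at [s] composed
   with the inverse transition map. *)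
Lemma rank_chart l s z : vertex P l -> vertex P s ->
  tdom l (tpoint X s z) ->
  (forall w, hyp_eq (v l) q a w = 0 ->
    \rank (jac (hyp_eq (v l) q a) w) = 1%N) ->
  (hyp_eq (v l) q a \o tcoord l) (tpoint X s z) = 0 ->
  \rank (jac ((hyp_eq (v l) q a \o tcoord l) \o tpoint X s) z) = 1%N.
Proof.
move=> vl vs lz rk fz;
pose w := tcoord l (tpoint X s z).
have wz : tpoint X l w = tpoint X s z by rewrite /w tcoordK// inE.
have sw : tdom s (tpoint X l w) by rewrite wz; exact: (tpoint_dom X).
have tw : transition (v l) (v s) w = z.
  by rewrite -(ttransition (t := X) vl vs)// wz tpointK.
rewrite -tw; apply: (rank_jac_factor _ _ _ _ _ _ _ _ (rk w fz)).
- exact: differentiable_hyp_eq.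
- by apply: differentiable_transition; exact: (toverlap X vl vs w).1 sw.
- by rewrite tw; exact: differentiable_chart.
near=> y; have sy : tdom s (tpoint X l y) by near: y; exact: near_tdom.
have Ty := ttransition vl vs sy.
have yK := tcoordK vs (mem_set sy).
by rewrite !compE -Ty yK (tpointK X vl).
Unshelve. all: by end_near. Qed.

End ToricHypersurface.

Theorem theorem1p3 (R : realType) (m : nat)
    (Delta : set 'rV[R]_m.+1)
    (v : 'rV[R]_m.+1 -> 'I_m.+1 -> 'rV[int]_m.+1)
    (X : toricManifold Delta v)
    (V : set 'rV[R]_m.+1) (p : 'I_m -> 'rV[int]_m.+1) (a : 'rV[R]_m.+1)
    (q : 'rV[int]_m.+1) :
  delzant Delta ->
  (forall l, vertex Delta l -> edge_directions Delta l (v l)) ->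
  affine_subspace m V -> rational_slope V -> presentation V p a ->
  primitive_normal V q ->
  admissible Delta v p ->
  (forall l, vertex Delta l ->
     forall z, zero_locus (hyp_eq (v l) q a) z ->
       \rank (jac (hyp_eq (v l) q a) z) = 1%N) /\
  smooth_hypersurface (hypersurface X q a).
Proof.
move=> [cP _] ve _ _ Vpa Vq adm.
have Qv l : vertex Delta l -> Qmx (v l) \in unitmx.
  by move=> /ve[/zbasis_unitmx].
have rk l : vertex Delta l -> forall z, hyp_eq (v l) q a z = 0 ->
    \rank (jac (hyp_eq (v l) q a) z) = 1%N.
  move=> vl z; apply: hyp_eq_rank; [exact: Qv|exact: Vq.1|].
  exact: (admissible_coef cP (ve l vl) Vpa Vq adm vl).
split; first exact: rk.
split; first exact: closed_hypersurface.
move=> x [l vl [z fz <-]].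
(* The whole chart domain serves as neighbourhood, with the equation of that chart as the local
   one. *)
exists (tdom (t := X) l), (hyp_eq (v l) q a \o tcoord l).
split.
- exact: (tdom_open X vl).
- exact: (tpoint_dom X).
- by move=> s vs w lw; exact: differentiable_chart.
- by move=> y ly; exact: hypersurface_chart.
- by move=> s vs w lw gw; apply: rank_chart => //; exact: rk.
Qed.
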